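(* Let $\Lambda = KQ/I$ be the truncated path algebra of Loewy length $L+1$ (with $L \ge 1$) on a finite quiver $Q$ over a field $K$. Suppose $q \in \Lambda$ is a path of length $l > 0$ in $\Lambda$ (i.e., the $I$-residue of a path of length $l$ in $KQ$, $1 \le l \le L$) with terminal vertex $e$. Let $c = c(e)\in \mathbb{N}\cup\{0,\infty\}$ be the supremum of the lengths of the paths in $KQ$ starting in $e$. Then the left $\Lambda$-module $\Lambda q$ satisfies $$\operatorname{p\,dim} \Lambda q = l\text{-}\deg(c).$$ In particular, $\operatorname{p\,dim} \Lambda q < \infty$ if and only if $c(e) < \infty$ (meaning that there is no path starting in $e$ and terminating on an oriented cycle). Moreover, if $q'$ is another path in $\Lambda$ that ends in $e$ such that $L \ge \operatorname{length}(q') \ge \operatorname{length}(q) \ge 1$, then $$\operatorname{p\,dim} \Lambda q \le \operatorname{p\,dim} \Lambda q' \le 1 + \operatorname{p\,dim}\Lambda q .$$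
   Context: $L$ is a fixed positive integer, $K$ a field, $Q$ a finite quiver, and $\Lambda = KQ/I$, where $I \subseteq KQ$ is the ideal generated by all paths of length $L+1$. The product $p'p$ of paths stands for ''$p'$ after $p$''. Modules are left modules. A path in $\Lambda$ is the $I$-residue of a path in $KQ$ of length at most $L$ (so it is nonzero in $\Lambda$), and its length is the length of that path in $KQ$; vertices are paths of length $0$. $\operatorname{p\,dim}$ denotes projective dimension. For an integer $0 \le l \le L$ and an integer $c \ge 0$, $$l\text{-}\deg(c) = \left[\frac{c}{L+1}\right] + \left[\frac{c+l}{L+1}\right],$$ where $[x]$ is the largest integer smaller than or equal to $x$; moreover $l\text{-}\deg(\infty) = \infty$. The convention $1+\infty=\infty$ is used. *)

(* Defs.v *)
From HB Require Import structures.
From mathcomp Require Import all_boot all_order all_algebra generic_quotient.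
From mathcomp Require Import finmap.
From mathcomp Require Import boolp.
From mathcomp Require Import monalg.

Set Implicit Arguments.
Unset Strict Implicit.
Unset Printing Implicit Defensive.

Import GRing.Theory.
Local Open Scope ring_scope.

(* The set N u {oo}; [None] stands for oo.                                    *)
Definition enat := option nat.

Definition enat_le (x y : enat) : bool :=
  match x, y with
  | _, None => true
  | None, Some _ => false
  | Some m, Some n => (m <= n)%N
  end.

Definition enat_succ (x : enat) : enat := omap S x.

(* The infimum in N u {oo}; the empty set has infimum oo. *)
Definition enat_inf (A : nat -> Prop) : enat :=
  if pselect (exists n, `[< A n >]) is left exA then Some (ex_minn exA)
  else None.

(* The supremum in N u {oo}, i.e. the least upper bound. *)
Definition enat_sup (A : nat -> Prop) : enat :=
  enat_inf (fun b => forall n, A n -> (n <= b)%N).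

Section TwoSidedIdeals.
Variable R : pzRingType.

(* Closure under opposites follows from closure under multiplication by -1. *)
Definition two_sided_ideal (J : R -> Prop) : Prop :=
  [/\ J 0,
      forall x y, J x -> J y -> J (x + y),
      forall a x, J x -> J (a * x) &
      forall a x, J x -> J (x * a)].

Definition ideal_gen (S : R -> Prop) (x : R) : Prop :=
  forall J, two_sided_ideal J -> (forall s, S s -> J s) -> J x.

Variable S : R -> Prop.

Definition in_ideal_gen : R -> bool := fun x => `[< ideal_gen S x >].

Lemma in_ideal_genP x : reflect (ideal_gen S x) (x \in in_ideal_gen).
Proof. exact: asboolP. Qed.

Lemma ideal_gen_ideal : two_sided_ideal (ideal_gen S).
Proof.
split=> [J JI _|x y Ix Iy J JI SJ|a x Ix J JI SJ|a x Ix J JI SJ].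
- by have [] := JI.
- by have [_ JD _ _] := JI; apply: JD; [apply: Ix | apply: Iy].
- by have [_ _ JM _] := JI; apply: JM; apply: Ix.
- by have [_ _ _ JM] := JI; apply: JM; apply: Ix.
Qed.

Lemma in_ideal_gen_zmod_closed : zmod_closed in_ideal_gen.
Proof.
have [I0 ID IM _] := ideal_gen_ideal; split=> [|x y]; first exact/in_ideal_genP.
move=> /in_ideal_genP Ix /in_ideal_genP Iy; apply/in_ideal_genP.
by rewrite -mulN1r; apply: ID => //; apply: IM.
Qed.

HB.instance Definition _ :=
  GRing.isZmodClosed.Build R in_ideal_gen in_ideal_gen_zmod_closed.

Definition gen_ideal : zmodClosed R := GRing.ZmodClosed.clone R in_ideal_gen _.

(* R / (S), with (S) the two-sided ideal generated by S; the quotients of     *)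
(* ring_quotient carry a multiplication for commutative rings only.           *)
Definition ringquot : Type := Quotient.quot gen_ideal.

HB.instance Definition _ := GRing.Zmodule.on ringquot.

Definition rq_pi (x : R) : ringquot :=
  (\pi_(Quotient.quot gen_ideal) x)%qT.

Definition rq_repr (x : ringquot) : R :=
  repr (x : Quotient.quot gen_ideal).

Lemma rq_reprK : cancel rq_repr rq_pi.
Proof. exact: reprK. Qed.

Lemma rq_piP x y : rq_pi x = rq_pi y <-> ideal_gen S (x - y).
Proof.
have e : (x - y \in in_ideal_gen) = (x == y %[mod Quotient.quot gen_ideal])%qT.
  exact: (Quotient.idealrBE gen_ideal).
split=> [xy|Ixy]; first by apply/in_ideal_genP; rewrite e; apply/eqP.
by apply/eqP; rewrite -[_ == _]e; apply/in_ideal_genP.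
Qed.

Lemma rq_piD : {morph rq_pi : x y / x + y}.
Proof. by move=> x y; rewrite /rq_pi !piE. Qed.

Definition rq_one : ringquot := rq_pi 1.
Definition rq_mul (x y : ringquot) : ringquot := rq_pi (rq_repr x * rq_repr y).

Lemma rq_piM x y : rq_pi (x * y) = rq_mul (rq_pi x) (rq_pi y).
Proof.
have [_ ID IMl IMr] := ideal_gen_ideal; apply/rq_piP.
set x' := rq_repr _; set y' := rq_repr _.
have Ix : ideal_gen S (x - x') by apply/rq_piP; rewrite rq_reprK.
have Iy : ideal_gen S (y - y') by apply/rq_piP; rewrite rq_reprK.
suff -> : x * y - x' * y' = (x - x') * y + x' * (y - y').
  by apply: ID; [apply: IMr | apply: IMl].
by rewrite mulrBl mulrBr addrA subrK.
Qed.

Lemma rq_mulA : associative rq_mul.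
Proof.
move=> x y z; rewrite -(rq_reprK x) -(rq_reprK y) -(rq_reprK z).
by rewrite -!rq_piM mulrA.
Qed.

Lemma rq_mul1 : left_id rq_one rq_mul.
Proof. by move=> x; rewrite -(rq_reprK x) -rq_piM mul1r. Qed.

Lemma rq_mulr1 : right_id rq_one rq_mul.
Proof. by move=> x; rewrite -(rq_reprK x) -rq_piM mulr1. Qed.

Lemma rq_mulDl : left_distributive rq_mul +%R.
Proof.
move=> x y z; rewrite -(rq_reprK x) -(rq_reprK y) -(rq_reprK z).
by rewrite -rq_piD -!rq_piM mulrDl rq_piD.
Qed.

Lemma rq_mulDr : right_distributive rq_mul +%R.
Proof.
move=> x y z; rewrite -(rq_reprK x) -(rq_reprK y) -(rq_reprK z).
by rewrite -rq_piD -!rq_piM mulrDr rq_piD.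
Qed.

HB.instance Definition _ := GRing.Zmodule_isPzRing.Build ringquot
  rq_mulA rq_mul1 rq_mulr1 rq_mulDl rq_mulDr.

End TwoSidedIdeals.

Section Modules.
Variable R : pzRingType.

Definition projective (P : lmodType R) : Prop :=
  forall (B C : lmodType R) (g : {linear B -> C}) (f : {linear P -> C}),
    (forall c, exists b, g b = c) ->
    exists h : {linear P -> B}, forall x, g (h x) = f x.

(* There is an exact sequence 0 -> P n -> ... -> P 1 -> P 0 -> M -> 0 with    *)
(* projective P i; it is extended by P i = 0 for i > n.                       *)
Definition has_proj_resolution (M : lmodType R) (n : nat) : Prop :=
  exists (P : nat -> lmodType R) (d : forall i, {linear P i.+1 -> P i})
         (aug : {linear P 0 -> M}),
    [/\ forall i, projective (P i),
        forall m, exists x, aug x = m,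
        forall x, aug x = 0 <-> exists y, d 0 y = x,
        forall i x, d i x = 0 <-> exists y, d i.+1 y = x &
        forall i, (n < i)%N -> forall x : P i, x = 0].

Definition pdim (M : lmodType R) : enat := enat_inf (has_proj_resolution M).

Variable x : R.

Definition lideal : R^o -> bool := fun y => `[< exists a : R, y = a * x >].

Lemma lideal_submod_closed : submod_closed lideal.
Proof.
split=> [|a _ _ /asboolP[b ->] /asboolP[c ->]]; apply/asboolP.
  by exists 0; rewrite mul0r.
by exists (a * b + c); rewrite mulrDl -mulrA.
Qed.

HB.instance Definition _ :=
  GRing.isSubmodClosed.Build R R^o lideal lideal_submod_closed.

(* The left R-module R x. *)
Record lprincipal : predArgType :=
  LPrincipal { lprincipal_val :> R^o; _ : lprincipal_val \in lideal }.

HB.instance Definition _ := [isSub for lprincipal_val].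
HB.instance Definition _ := [Choice of lprincipal by <:].
HB.instance Definition _ := [SubChoice_isSubLmodule of lprincipal by <:].

End Modules.

Record quiver := Quiver {
  vertex : finType;
  arrow : finType;
  asrc : arrow -> vertex;
  atgt : arrow -> vertex
}.

Section Paths.
Variable Q : quiver.

Fixpoint walk (v : vertex Q) (s : seq (arrow Q)) : bool :=
  if s is a :: s' then (asrc a == v) && walk (atgt a) s' else true.

(* A path is a starting vertex together with the arrows in the order in which *)
(* they are traversed.                                                        *)
Record qpath : predArgType := QPath {
  qpath_val : vertex Q * seq (arrow Q);
  _ : walk qpath_val.1 qpath_val.2
}.

HB.instance Definition _ := [isSub for qpath_val].
(* These instances are opaque so that unification in {malg K[qpath Q]} does   *)
(* not unfold them.                                                           *)
Fact qpath_hasDecEq : hasDecEq qpath.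
Proof.
exact: (Equality.eqtype_hasDecEq_mixin
          (Equality.class (sub_type qpath : eqType))).
Qed.
HB.instance Definition _ := qpath_hasDecEq.

Fact qpath_hasChoice : hasChoice qpath.
Proof.
exact: (Choice.choice_hasChoice_mixin
          (Choice.class (sub_type qpath : choiceType))).
Qed.
HB.instance Definition _ := qpath_hasChoice.


Definition psrc (p : qpath) : vertex Q := (val p).1.
Definition parrows (p : qpath) : seq (arrow Q) := (val p).2.
Definition pvertices (p : qpath) : seq (vertex Q) :=
  psrc p :: map (@atgt Q) (parrows p).
Definition ptgt (p : qpath) : vertex Q :=
  last (psrc p) (map (@atgt Q) (parrows p)).
Definition plength (p : qpath) : nat := size (parrows p).

Definition trivial_path (v : vertex Q) : qpath := @QPath (v, [::]) isT.

(* The product p' p, "p' after p"; it is [None] when p does not end where p'  *)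
(* starts, and [insub] always succeeds otherwise, see [pcompE].               *)
Definition pcomp (p' p : qpath) : option qpath :=
  if ptgt p == psrc p' then insub (psrc p, parrows p ++ parrows p') else None.

Lemma walk_cat v s t :
  walk v (s ++ t) = walk v s && walk (last v (map (@atgt Q) s)) t.
Proof. by elim: s v => //= a s IHs v; rewrite IHs andbA. Qed.

Lemma pcompE p' p : ptgt p = psrc p' ->
  omap val (pcomp p' p) = Some (psrc p, parrows p ++ parrows p').
Proof.
move=> e; rewrite /pcomp e eqxx insubT //=.
rewrite walk_cat; apply/andP; split; first exact: (valP p).
by have := valP p'; rewrite -/(psrc p') -/(parrows p') -e.
Qed.

Lemma pcompN p' p : ptgt p != psrc p' -> pcomp p' p = None.
Proof. by rewrite /pcomp => /negPf->. Qed.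

Lemma pcompP p' p r : pcomp p' p = Some r ->
  [/\ ptgt p = psrc p', psrc r = psrc p & parrows r = parrows p ++ parrows p'].
Proof.
have [e Er|ne] := eqVneq (ptgt p) (psrc p'); last by rewrite pcompN.
by have := pcompE e; rewrite Er /= => -[Ev]; rewrite /psrc /parrows /= Ev.
Qed.

Lemma pcomp_tgt p' p r : pcomp p' p = Some r -> ptgt r = ptgt p'.
Proof.
case/pcompP=> e es ea; rewrite /ptgt es ea map_cat last_cat.
by rewrite -/(ptgt p) e.
Qed.

Lemma qpath_eq (p r : qpath) :
  psrc p = psrc r -> parrows p = parrows r -> p = r.
Proof.
move=> es ea; apply: val_inj; move: es ea; rewrite /psrc /parrows.
by case: (val p) (val r) => ? ? [? ?] /= -> ->.
Qed.

Lemma pcompA p3 p2 p1 :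
  obind (pcomp p3) (pcomp p2 p1) = obind (pcomp^~ p1) (pcomp p3 p2).
Proof.
case E21: (pcomp p2 p1) => [r|] /=; case E32: (pcomp p3 p2) => [s|] //=.
- have [e21 rs ra] := pcompP E21; have [e32 ss sa] := pcompP E32.
  have er3 : ptgt r = psrc p3 by rewrite (pcomp_tgt E21).
  have e1s : ptgt p1 = psrc s by rewrite ss.
  have := pcompE er3; have := pcompE e1s.
  case: (pcomp s p1) => //= x [Ex]; case: (pcomp p3 r) => //= y [Ey].
  by congr Some; apply: val_inj; rewrite /= Ex Ey rs ra sa catA.
- have [e21 rs ra] := pcompP E21.
  apply: pcompN; rewrite (pcomp_tgt E21); apply/negP=> /eqP e.
  by have := pcompE e; rewrite E32.
- have [e32 ss sa] := pcompP E32.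
  apply/esym/pcompN; rewrite ss; apply/negP=> /eqP e.
  by have := pcompE e; rewrite E21.
Qed.

Lemma pcomp_trivial_l v p :
  pcomp (trivial_path v) p = if ptgt p == v then Some p else None.
Proof.
have [e|ne] := eqVneq (ptgt p) v; last exact: pcompN.
have := @pcompE (trivial_path v) p e; case: (pcomp _ _) => //= r [Er].
by congr Some; apply: val_inj; rewrite /= Er cats0 /psrc /parrows /=; case: (qpath_val p).
Qed.

Lemma pcomp_trivial_r v p :
  pcomp p (trivial_path v) = if psrc p == v then Some p else None.
Proof.
rewrite eq_sym; have [e|ne] := eqVneq v (psrc p); last exact: pcompN.
have := @pcompE p (trivial_path v) e; case: (pcomp _ _) => //= r [Er].
by congr Some; apply: val_inj; rewrite /= Er /= e /psrc /parrows /=; case: (qpath_val p).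
Qed.

Definition max_path_length (e : vertex Q) : enat :=
  enat_sup (fun n => exists2 p : qpath, psrc p = e & plength p = n).

Definition oriented_cycle (z : qpath) : Prop :=
  (0 < plength z)%N /\ psrc z = ptgt z.

Definition on_oriented_cycle (v : vertex Q) : Prop :=
  exists2 z : qpath, oriented_cycle z & v \in pvertices z.

End Paths.

Definition pathalg (K : fieldType) (Q : quiver) : Type := {malg K[qpath Q]}.

Section PathAlgebra.
Variables (K : fieldType) (Q : quiver).
Local Notation KQ := (pathalg K Q).

HB.instance Definition _ := GRing.Lmodule.on KQ.

Definition path_elt (p : qpath Q) : KQ := << p >>%M.

Definition path_mul (p' p : qpath Q) : KQ :=
  if pcomp p' p is Some r then path_elt r else 0.

Definition pa_mul (f g : KQ) : KQ :=
  \sum_(p' <- msupp f) \sum_(p <- msupp g)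
    (mcoeff p' f * mcoeff p g) *: path_mul p' p.

Definition pa_one : KQ := \sum_(v : vertex Q) path_elt (trivial_path v).

Lemma pathalgE (f : KQ) : f = \sum_(p <- msupp f) mcoeff p f *: path_elt p.
Proof.
rewrite {1}[f](@monalgE (qpath Q) K); apply: eq_bigr => p _.
by apply/malgP => r; rewrite mcoeffZ !mcoeffU mulr_natr.
Qed.

Lemma pa_mulEw (d1 d2 : {fset qpath Q}) (f g : KQ) :
  (msupp f `<=` d1)%fset -> (msupp g `<=` d2)%fset ->
  pa_mul f g = \sum_(p' <- d1) \sum_(p <- d2)
    (mcoeff p' f * mcoeff p g) *: path_mul p' p.
Proof.
move=> le_d1 le_d2; rewrite /pa_mul (big_fset_incl _ le_d1) /=.
  apply/eq_bigr=> k1 _; apply/big_fset_incl => // k _ /mcoeff_outdom ->.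
  by rewrite mulr0 scale0r.
move=> k _ /mcoeff_outdom fk.
by rewrite big1 => // k' _; rewrite fk mul0r scale0r.
Qed.

Lemma pa_mulDl : left_distributive pa_mul +%R.
Proof.
move=> f1 f2 g; set d := (msupp f1 `|` msupp f2)%fset.
have l1 : (msupp f1 `<=` d)%fset by exact: fsubsetUl.
have l2 : (msupp f2 `<=` d)%fset by exact: fsubsetUr.
have l12 : (msupp (f1 + f2 : KQ) `<=` d)%fset by exact: msuppD_le.
rewrite (pa_mulEw l12 (fsubset_refl _)) (pa_mulEw l1 (fsubset_refl _)).
rewrite (pa_mulEw l2 (fsubset_refl _)) -big_split /=; apply/eq_bigr=> k1 _.
rewrite -big_split /=; apply/eq_bigr=> k2 _.
by rewrite mcoeffD mulrDl scalerDl.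
Qed.

Lemma pa_mulDr : right_distributive pa_mul +%R.
Proof.
move=> g f1 f2; set d := (msupp f1 `|` msupp f2)%fset.
have l1 : (msupp f1 `<=` d)%fset by exact: fsubsetUl.
have l2 : (msupp f2 `<=` d)%fset by exact: fsubsetUr.
have l12 : (msupp (f1 + f2 : KQ) `<=` d)%fset by exact: msuppD_le.
rewrite (pa_mulEw (fsubset_refl _) l12) (pa_mulEw (fsubset_refl _) l1).
rewrite (pa_mulEw (fsubset_refl _) l2) -big_split /=; apply/eq_bigr=> k1 _.
rewrite -big_split /=; apply/eq_bigr=> k2 _.
by rewrite mcoeffD mulrDr scalerDl.
Qed.

Lemma pa_mul0l (g : KQ) : pa_mul 0 g = 0.
Proof. by rewrite /pa_mul msupp0 big_seq_fset0. Qed.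

Lemma pa_mul0r (g : KQ) : pa_mul g 0 = 0.
Proof. by rewrite /pa_mul msupp0; apply: big1 => i _; rewrite big_seq_fset0. Qed.

Lemma pa_mulZl (a : K) (f g : KQ) : pa_mul (a *: f) g = a *: pa_mul f g.
Proof.
rewrite (pa_mulEw (msuppZ_le a f) (fsubset_refl _)) /pa_mul scaler_sumr.
apply: eq_bigr => k1 _; rewrite scaler_sumr; apply: eq_bigr => k2 _.
by rewrite mcoeffZ scalerA mulrA.
Qed.

Lemma pa_mulZr (a : K) (f g : KQ) : pa_mul f (a *: g) = a *: pa_mul f g.
Proof.
rewrite (pa_mulEw (fsubset_refl _) (msuppZ_le a g)) /pa_mul scaler_sumr.
apply: eq_bigr => k1 _; rewrite scaler_sumr; apply: eq_bigr => k2 _.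
by rewrite mcoeffZ scalerA mulrCA.
Qed.

Lemma pa_mul_sumZl I (s : seq I) (a : I -> K) (F : I -> KQ) (g : KQ) :
  pa_mul (\sum_(i <- s) a i *: F i) g = \sum_(i <- s) a i *: pa_mul (F i) g.
Proof.
rewrite (big_morph (pa_mul^~ g) (fun _ _ => pa_mulDl _ _ _) (pa_mul0l _)).
by apply: eq_bigr => i _; rewrite pa_mulZl.
Qed.

Lemma pa_mul_sumZr I (s : seq I) (a : I -> K) (F : I -> KQ) (g : KQ) :
  pa_mul g (\sum_(i <- s) a i *: F i) = \sum_(i <- s) a i *: pa_mul g (F i).
Proof.
rewrite (big_morph (pa_mul g) (fun _ _ => pa_mulDr _ _ _) (pa_mul0r _)).
by apply: eq_bigr => i _; rewrite pa_mulZr.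
Qed.

Lemma pa_mul_path p' p : pa_mul (path_elt p') (path_elt p) = path_mul p' p.
Proof.
rewrite /pa_mul /path_elt !msuppU oner_eq0 !big_seq_fset1 !mcoeffUU.
by rewrite mulr1 scale1r.
Qed.

Lemma pa_mulA_path p3 p2 p1 :
  pa_mul (path_elt p3) (pa_mul (path_elt p2) (path_elt p1)) =
  pa_mul (pa_mul (path_elt p3) (path_elt p2)) (path_elt p1).
Proof.
rewrite !pa_mul_path /path_mul; move: (pcompA p3 p2 p1).
case: (pcomp p2 p1) => [r|]; case: (pcomp p3 p2) => [s|] /= E.
- by rewrite !pa_mul_path /path_mul E.
- by apply: etrans (pa_mul_path _ _) _; rewrite /path_mul E (pa_mul0l (path_elt p1)).
- by apply: etrans (pa_mul0r _) _; rewrite pa_mul_path /path_mul -E.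
- by apply: etrans (pa_mul0r _) _; rewrite (pa_mul0l (path_elt p1)).
Qed.

Lemma pa_mulA : associative pa_mul.
Proof.
move=> f g h.
rewrite [f]pathalgE !pa_mul_sumZl; apply: eq_bigr => p3 _; congr (_ *: _).
rewrite [g]pathalgE !(pa_mul_sumZl, pa_mul_sumZr); apply: eq_bigr => p2 _.
congr (_ *: _); rewrite [h]pathalgE !pa_mul_sumZr.
by apply: eq_bigr => p1 _; rewrite pa_mulA_path.
Qed.

Lemma pa_mul1 : left_id pa_one pa_mul.
Proof.
move=> f; rewrite [f]pathalgE pa_mul_sumZr; apply: eq_bigr => p _.
congr (_ *: _); rewrite /pa_one.
rewrite (big_morph (pa_mul^~ _) (fun _ _ => pa_mulDl _ _ _) (pa_mul0l _)).
under eq_bigr do rewrite pa_mul_path /path_mul pcomp_trivial_l.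
rewrite (bigD1 (ptgt p)) //= eqxx big1 ?addr0 // => v /negPf ne.
by rewrite eq_sym ne.
Qed.

Lemma pa_mulr1 : right_id pa_one pa_mul.
Proof.
move=> f; rewrite [f]pathalgE pa_mul_sumZl; apply: eq_bigr => p _.
congr (_ *: _); rewrite /pa_one.
rewrite (big_morph (pa_mul _) (fun _ _ => pa_mulDr _ _ _) (pa_mul0r _)).
under eq_bigr do rewrite pa_mul_path /path_mul pcomp_trivial_r.
rewrite (bigD1 (psrc p)) //= eqxx big1 ?addr0 // => v /negPf ne.
by rewrite eq_sym ne.
Qed.

HB.instance Definition _ := GRing.Zmodule_isPzRing.Build KQ
  pa_mulA pa_mul1 pa_mulr1 pa_mulDl pa_mulDr.

Lemma path_eltM p' p : path_elt p' * path_elt p = path_mul p' p.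
Proof. exact: pa_mul_path. Qed.

(* KQ / I, with I generated by the paths of length L + 1. *)
Definition truncalg (L : nat) : pzRingType :=
  ringquot (fun x : KQ => exists2 p : qpath Q, plength p = L.+1 & x = path_elt p).

Definition residue (L : nat) (p : qpath Q) : truncalg L := rq_pi _ (path_elt p).

End PathAlgebra.

Definition ldeg (L l : nat) (c : enat) : enat :=
  omap (fun n => n %/ L.+1 + (n + l) %/ L.+1)%N c.

(* The left module Lambda q, with q the residue of p. *)
Definition path_module (K : fieldType) (Q : quiver) (L : nat) (p : qpath Q) :
    lmodType (truncalg K Q L) :=
  lprincipal (residue K L p).

(* Main.v *)
Require Import Defs.
From HB Require Import structures.
From mathcomp Require Import all_boot all_algebra finmap boolp monalg zify.

(** Let [q] be a path of length [l] from the truncated path algebra [Lambda],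
    with [1 <= l <= L], let [e] be its end and [k = L + 1 - l].  Right
    multiplication by [q] maps the projective module [Lambda e] onto
    [Lambda q]; it sends a path [r] starting in [e] to [r q], which vanishes
    exactly when [r] has length at least [k].  A path of length at least [k]
    has exactly one initial subpath of length [k], so the kernel is the direct
    sum of the modules [Lambda p], where [p] runs over the paths of length [k]
    starting in [e] ([syzygy_path_module]).  Those [p] satisfy
    [1 <= k <= L] again, so the description can be iterated.

    If the longest path starting in [e] has length [c < k], the kernel is zero
    and [Lambda q] is projective.  Otherwise the parameters [(l, c)] are
    replaced by [(k, c')] with [c' <= c - k], where [c - k] is attained, and
    the projective dimension goes up by one.  The number
    [c %/ (L + 1) + (c + l) %/ (L + 1)] obeys the same recursion
    ([ldegn_syzygy]), because [c + l = (c - k) + (L + 1)] and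
    [(c - k) + k = c]: the two quotients swap their roles.

    The upper bound [path_module_upper] splices resolutions of the kernels.
    For the lower bound [path_module_lower], every resolution of [Lambda q]
    must be compared with the syzygy above.  This is Schanuel's argument, used
    in a weak form: if a module is a retract of one with a resolution of
    length [n + 1], then its syzygies are retracts of modules with a resolution
    of length [n] ([retract_resolution_shift]).  Retracts are harmless because
    a retract of a projective module is projective, and they make the passage
    to the single summand [Lambda p] immediate.  The descent along a path of
    length [c] starting in [e] ends with a module that is not projective
    ([path_module_not_projective]) whenever the bound would be violated.  The
    lower bound only needs one path of length [c]; when [c(e)] is infinite
    it therefore excludes all finite lengths.

    Finally, [c(e)] is finite exactly when no oriented cycle can be reached
    from [e]: going round a cycle gives arbitrarily long paths, and conversely a
    path with at least as many arrows as there are vertices repeats a vertex. *)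

Set Implicit Arguments.
Unset Strict Implicit.
Unset Printing Implicit Defensive.

Import GRing.Theory.
Local Open Scope ring_scope.

(* The product of paths, not the composition of partial functions. *)
Local Notation pcomp := Defs.pcomp.

(** * Projective resolutions, retracts and dimension shifting *)

Section LinearMaps.
Variable R : pzRingType.
Implicit Types A B C M N P : lmodType R.

Definition linear_of A B (f : A -> B) (lin_f : linear f) : {linear A -> B} :=
  HB.pack f (GRing.isLinear.Build R A B *:%R f lin_f).

Lemma factor_injective A N P (i : {linear N -> P}) (f : {linear A -> P}) :
  injective i -> (forall x, exists y, i y = f x) ->
  exists h : {linear A -> N}, forall x, i (h x) = f x.
Proof.
move=> inj_i /choice[h ih]; have lin_h : linear h.
  by move=> a x y; apply: inj_i; rewrite linearP !ih linearP.
by exists (linear_of lin_h).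
Qed.

Lemma factor_surjective A M P (p : {linear P -> M}) (f : {linear P -> A}) :
  (forall m, exists x, p x = m) -> (forall x, p x = 0 -> f x = 0) ->
  exists h : {linear M -> A}, forall x, h (p x) = f x.
Proof.
move=> /choice[s ps] kpf.
have eqf x y : p x = p y -> f x = f y.
  move=> e; apply/eqP; rewrite -subr_eq0 -linearB; apply/eqP/kpf.
  by rewrite linearB e subrr.
have lin_h : linear (f \o s).
  by move=> a x y /=; rewrite -linearP; apply: eqf; rewrite linearP !ps.
by exists (linear_of lin_h) => x; apply: eqf; rewrite ps.
Qed.

Section PairMap.
Variables (A B C D : lmodType R) (f : {linear A -> C}) (g : {linear B -> D}).

Definition pair_map (x : A * B) : C * D := (f x.1, g x.2).

Fact pair_map_linear : linear pair_map.
Proof.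
by move=> a x y; rewrite /pair_map /= !linearP.
Qed.

HB.instance Definition _ :=
  GRing.isLinear.Build R (A * B)%type (C * D)%type *:%R pair_map pair_map_linear.
End PairMap.

Section Copair.
Variables (A B C : lmodType R) (f : {linear A -> C}) (g : {linear B -> C}).

Definition copair (x : A * B) : C := f x.1 + g x.2.

Fact copair_linear : linear copair.
Proof. by move=> a x y; rewrite /copair /= !linearP scalerDr addrACA. Qed.

HB.instance Definition _ :=
  GRing.isLinear.Build R (A * B)%type C *:%R copair copair_linear.
End Copair.

Section PairOf.
Variables (A B C : lmodType R) (f : {linear A -> B}) (g : {linear A -> C}).

Definition pair_of (x : A) : B * C := (f x, g x).

Fact pair_of_linear : linear pair_of.
Proof. by move=> a x y; rewrite /pair_of !linearP. Qed.

HB.instance Definition _ :=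
  GRing.isLinear.Build R A (B * C)%type *:%R pair_of pair_of_linear.
End PairOf.

Section Kernel.
Variables (A B : lmodType R) (f : {linear A -> B}).

Definition in_kernel : A -> bool := fun x => f x == 0.

Fact in_kernel_submod_closed : submod_closed in_kernel.
Proof.
split=> [|a x y]; first by rewrite unfold_in /in_kernel linear0.
by rewrite !unfold_in /in_kernel linearP => /eqP-> /eqP->; rewrite scaler0 addr0.
Qed.

HB.instance Definition _ :=
  GRing.isSubmodClosed.Build R A in_kernel in_kernel_submod_closed.

Record kernel : predArgType :=
  Kernel { kernel_val :> A; _ : kernel_val \in in_kernel }.

HB.instance Definition _ := [isSub for kernel_val].
HB.instance Definition _ := [Choice of kernel by <:].
HB.instance Definition _ := [SubChoice_isSubLmodule of kernel by <:].

Fact kernel_val_linear : linear kernel_val.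
Proof. exact: (@linearP _ _ _ _ (\val : kernel -> A)). Qed.

HB.instance Definition _ :=
  GRing.isLinear.Build R kernel A *:%R kernel_val kernel_val_linear.

Lemma kernel_val_inj : injective kernel_val.
Proof. exact: val_inj. Qed.

Lemma kernelP x : f x = 0 <-> exists y : kernel, y = x :> A.
Proof.
split=> [fx0|[[y /eqP ky] <-] //].
have kx : x \in in_kernel by apply/eqP.
by exists (Kernel kx).
Qed.
End Kernel.

Definition short_exact N P M (i : {linear N -> P}) (p : {linear P -> M}) :=
  [/\ injective i, forall m, exists x, p x = m &
      forall x, p x = 0 <-> exists y, i y = x].

Definition retract M M' :=
  exists (i : {linear M -> M'}) (r : {linear M' -> M}), cancel i r.

Lemma retract_refl M : retract M M.
Proof. by exists idfun, idfun. Qed.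

Lemma retract_trans M N P : retract M N -> retract N P -> retract M P.
Proof.
move=> [i [r ir]] [j [s js]].
by exists (j \o i), (r \o s) => x /=; rewrite js ir.
Qed.

Lemma projective_retract M P : retract M P -> projective P -> projective M.
Proof.
move=> [i [r ir]] projP B C g f sg.
have [h gh] := projP B C g (f \o r) sg.
by exists (h \o i) => x /=; rewrite gh /= ir.
Qed.

Lemma projective_iso M P (p : {linear P -> M}) :
  (forall m, exists x, p x = m) -> (forall x, p x = 0 -> x = 0) ->
  projective P -> projective M.
Proof.
move=> sp inj_p; apply: projective_retract.
have [h hp] := @factor_surjective P M P p idfun sp inj_p.
by exists h, p => m; have [x <-] := sp m; rewrite hp.
Qed.

Lemma projective_pair A B :
  projective A -> projective B -> projective (A * B)%type.
Proof.
move=> pA pB X Y g f sg.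
have [h gh] := pA X Y g (f \o pair_of idfun \0) sg.
have [k gk] := pB X Y g (f \o pair_of \0 idfun) sg.
exists (copair h k) => -[x y].
rewrite /copair linearD gh gk /= -linearD; congr (f _).
by apply/pair_equal_spec; rewrite /= addr0 add0r.
Qed.

Definition zero_module : lmodType R := 'rV[R]_0.

Lemma zero_moduleE (x : zero_module) : x = 0.
Proof. exact: thinmx0. Qed.

Lemma projective_zero : projective zero_module.
Proof.
by move=> B C g f _; exists \0 => x; rewrite (zero_moduleE x) !linear0.
Qed.

Lemma has_proj_resolution_projective M n :
  projective M -> has_proj_resolution M n.
Proof.
move=> projM; exists (fun i => if i is 0%N then M else zero_module).
exists (fun i => \0), idfun; split=> //.
- by case=> // i; exact: projective_zero.
- by move=> m; exists m.
- by move=> x; split=> [x0|[_ <-]] //; exists 0.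
- by move=> i x; split=> // _; exists 0; rewrite (zero_moduleE x).
- by case=> // i _ x; exact: zero_moduleE.
Qed.

Lemma has_proj_resolution_pair A B n :
  has_proj_resolution A n -> has_proj_resolution B n ->
  has_proj_resolution (A * B)%type n.
Proof.
move=> [P [d [a [pP sa ka kd P0]]]] [S [c [b [pS sb kb kc S0]]]].
have exact_pair (X X' Y Y' Z Z' : lmodType R)
    (f : {linear X -> Y}) (f' : {linear X' -> Y'})
    (g : {linear Y -> Z}) (g' : {linear Y' -> Z'}) :
    (forall x, g x = 0 <-> exists y, f y = x) ->
    (forall x, g' x = 0 <-> exists y, f' y = x) ->
    forall x, pair_map g g' x = 0 <-> exists y, pair_map f f' y = x.
  move=> kg kg' [x x']; split=> [[/kg[y <-] /kg'[y' <-]]|]; first by exists (y, y').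
  move=> [[y y']] [ex ex']; congr (_, _).
    by apply/kg; exists y.
  by apply/kg'; exists y'.
exists (fun i => (P i * S i)%type), (fun i => pair_map (d i) (c i)).
exists (pair_map a b); split.
- by move=> i; apply: projective_pair.
- by move=> [x y]; have [x' <-] := sa x; have [y' <-] := sb y; exists (x', y').
- exact: exact_pair.
- by move=> i; apply: exact_pair.
- by move=> i lt_ni [x y]; rewrite (P0 i lt_ni x) (S0 i lt_ni y).
Qed.

(** Splicing: a resolution of a syzygy is prolonged by the projective module
    that covers [M]. *)
Lemma has_proj_resolution_cons N P M n
    (i : {linear N -> P}) (p : {linear P -> M}) :
  short_exact i p -> projective P ->
  has_proj_resolution N n -> has_proj_resolution M n.+1.
Proof.
move=> [inj_i sp kp] projP [S [d [a [pS sa ka kd S0]]]].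
pose T j : lmodType R := if j is j'.+1 then S j' else P.
pose c j : {linear T j.+1 -> T j} :=
  match j return {linear S j -> T j} with 0%N => i \o a | j'.+1 => d j' end.
exists T, c, p.
split=> //.
- by case.
- move=> x; split=> [/kp[y <-]|[y <-]].
    by have [z <-] := sa y; exists z.
  by apply/kp; exists (a y).
- case=> [|j] x; last exact: kd.
  split=> [|/ka ax0]; last by rewrite /= ax0 linear0.
  by rewrite /= -[RHS](linear0 i) => /inj_i/ka.
- by case=> // j; apply: S0.
Qed.

Lemma has_proj_resolution0 M : has_proj_resolution M 0 -> projective M.
Proof.
move=> [P [d [a [pP sa ka _ P0]]]].
apply: (projective_iso sa) (pP 0%N) => x /ka[y <-].
by rewrite (P0 1%N isT y) linear0.
Qed.

(** The kernel of the augmentation is resolved by the remaining terms. *)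
Lemma has_proj_resolution_kernel M n : has_proj_resolution M n.+1 ->
  exists N P (i : {linear N -> P}) (p : {linear P -> M}),
    [/\ short_exact i p, projective P & has_proj_resolution N n].
Proof.
move=> [P [d [a [pP sa ka kd P0]]]].
exists (kernel a), (P 0%N), (@kernel_val _ _ a), a; split=> //.
  by split=> //; [exact: kernel_val_inj | exact: kernelP].
have [|a' a'E] := factor_injective (f := d 0%N) (@kernel_val_inj _ _ a).
  by move=> x; apply/(kernelP a)/ka; exists x.
exists (fun i => P i.+1), (fun i => d i.+1), a'; split=> //.
- move=> m; have /ka[x ex] : a (kernel_val m) = 0 by apply/kernelP; exists m.
  by exists x; apply: kernel_val_inj; rewrite a'E.
- move=> x; rewrite -kd -a'E; split=> [->|]; first exact: linear0.
  by rewrite -[RHS](linear0 (@kernel_val _ _ a)) => /kernel_val_inj.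
- by move=> i lt_ni x; exact: (P0 i.+1 lt_ni x).
Qed.

(** That [M] itself then has a resolution of length [n] is true but takes more
    work; this weaker notion also characterizes projective dimension at most
    [n], and it is visibly inherited by direct summands. *)
Definition retract_resolution M n :=
  exists2 M', retract M M' & has_proj_resolution M' n.

Lemma retract_resolution_refl M n :
  has_proj_resolution M n -> retract_resolution M n.
Proof. by exists M => //; exact: retract_refl. Qed.

Lemma retract_resolution_retract M N n :
  retract M N -> retract_resolution N n -> retract_resolution M n.
Proof. by move=> rMN [P rNP resP]; exists P => //; apply: retract_trans rNP. Qed.

Lemma retract_resolution0 M : retract_resolution M 0 -> projective M.
Proof. by move=> [P rMP /has_proj_resolution0]; apply: projective_retract. Qed.

(** A form of Schanuel's lemma.  Let [M] be a retract of [M'], and let [N'] be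
    the first syzygy in a resolution of [M'].  The maps between [M] and [M']
    lift to [f : P -> P'] and [g : P' -> P], and [x - g (f x)] lies in [N] for
    every [x] since [g \o f] lifts the identity of [M].  Hence
    [x |-> (f x, x)] and [(y, x) |-> g y + (x - g (f x))] exhibit [N] as a
    retract of [N' * P], which has a resolution as short as that of [N']. *)
Lemma retract_resolution_shift N P M n
    (i : {linear N -> P}) (p : {linear P -> M}) :
  short_exact i p -> projective P ->
  retract_resolution M n.+1 -> retract_resolution N n.
Proof.
move=> [inj_i sp kp] projP [M' [u [r ur]] /has_proj_resolution_kernel].
move=> [N' [P' [i' [p' [[inj_i' sp' kp'] projP' resN']]]]].
have [f fE] := projP _ _ p' (u \o p) sp'.
have [g gE] := projP' _ _ p (r \o p') sp.
have [f' f'E] : exists f' : {linear N -> N'}, forall x, i' (f' x) = f (i x).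
  apply: (factor_injective (f := f \o i)) => // x; apply/kp'; rewrite fE /=.
  by have -> : p (i x) = 0 by [apply/kp; exists x]; rewrite linear0.
have [g' g'E] : exists g' : {linear N' -> N}, forall y, i (g' y) = g (i' y).
  apply: (factor_injective (f := g \o i')) => // y; apply/kp; rewrite gE /=.
  by have -> : p' (i' y) = 0 by [apply/kp'; exists y]; rewrite linear0.
have [t tE] : exists t : {linear P -> N}, forall x, i (t x) = x - g (f x).
  have lin_k : linear (fun x => x - g (f x)).
    move=> a x y; have -> : g (f (a *: x + y)) = a *: g (f x) + g (f y).
      by rewrite !linearP.
    by rewrite opprD addrACA -scalerBr.
  apply: (factor_injective (f := linear_of lin_k)) => // x; apply/kp => /=.
  by rewrite linearB gE /= fE /= ur subrr.
exists (N' * P)%type.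
  exists (pair_of f' i), (copair g' t) => x; apply: inj_i.
  by rewrite /copair linearD g'E tE /= f'E addrC subrK.
exact: has_proj_resolution_pair (has_proj_resolution_projective n projP).
Qed.

End LinearMaps.

(** * Subpaths and convolution in the path algebra *)

Section Subpaths.
Variable Q : quiver.
Implicit Types p r s : qpath Q.

Fact ptake_walk i s : walk (psrc s) (take i (parrows s)).
Proof.
have := valP s; rewrite -/(psrc s) -/(parrows s) -{1}(cat_take_drop i (parrows s)).
by rewrite walk_cat => /andP[].
Qed.

Definition ptake i s : qpath Q := @QPath Q (_, _) (ptake_walk i s).

Fact pdrop_walk i s : walk (ptgt (ptake i s)) (drop i (parrows s)).
Proof.
have := valP s; rewrite -/(psrc s) -/(parrows s) -{1}(cat_take_drop i (parrows s)).
by rewrite walk_cat => /andP[].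
Qed.

Definition pdrop i s : qpath Q := @QPath Q (_, _) (pdrop_walk i s).

Lemma parrows_drop i s : parrows (pdrop i s) = drop i (parrows s).
Proof. by []. Qed.

Lemma plength_take i s : (i <= plength s)%N -> plength (ptake i s) = i.
Proof. exact: size_takel. Qed.

Lemma plength_drop i s : plength (pdrop i s) = (plength s - i)%N.
Proof. exact: size_drop. Qed.

Lemma ptgt_drop i s : ptgt (pdrop i s) = ptgt s.
Proof.
by rewrite {2}/ptgt -(cat_take_drop i (parrows s)) map_cat last_cat.
Qed.

Lemma ptake0 s : ptake 0 s = trivial_path (psrc s).
Proof. by apply: qpath_eq => //; exact: take0. Qed.

Lemma ptake_take i j s : (i <= j)%N -> ptake i (ptake j s) = ptake i s.
Proof. by move=> leij; apply: qpath_eq => //; rewrite /= /parrows /= take_takel. Qed.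

Lemma psrc_drop i s : psrc (pdrop i s) = ptgt (ptake i s).
Proof. by []. Qed.

Lemma pdrop0 s : pdrop 0 s = s.
Proof.
by apply: qpath_eq; rewrite ?psrc_drop ?ptake0 // parrows_drop drop0.
Qed.

Lemma ptake_plength s : ptake (plength s) s = s.
Proof. by apply: qpath_eq; last exact: take_size. Qed.

Lemma pdrop_plength s : pdrop (plength s) s = trivial_path (ptgt s).
Proof.
by apply: qpath_eq; rewrite ?psrc_drop ?ptake_plength // parrows_drop drop_size.
Qed.

(** A path has one factorization for each length of the first factor. *)
Lemma pcomp_eq_Some p' p s : (pcomp p' p == Some s) =
  [&& plength p <= plength s, p' == pdrop (plength p) s
    & p == ptake (plength p) s]%N.
Proof.
apply/eqP/and3P => [/pcompP[pp' ss sa]|[le_ps /eqP p'E /eqP pE]].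
  have tE : p = ptake (plength p) s.
    by apply: qpath_eq; rewrite ?ss // /parrows /= -/(parrows s) sa take_size_cat.
  split; last exact/eqP.
    by rewrite /plength sa size_cat leq_addr.
  apply/eqP/qpath_eq; first by rewrite -pp' {1}tE.
  by rewrite parrows_drop sa drop_size_cat.
have pp' : ptgt p = psrc p' by rewrite p'E {1}pE.
have := pcompE pp'; case: (pcomp p' p) => //= r [rE]; congr Some.
have [rs ra] : psrc r = psrc p /\ parrows r = parrows p ++ parrows p'.
  by rewrite {1}/psrc {1}/parrows /= rE.
apply: qpath_eq; rewrite ?rs ?ra; first by rewrite pE.
by rewrite p'E parrows_drop {1}pE cat_take_drop.
Qed.

Definition starts_with p s := ptake (plength p) s == p.

Lemma starts_with_length p s : starts_with p s -> (plength p <= plength s)%N.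
Proof.
move=> /eqP <-; exact: leq_trans (eq_leq (size_take_min _ _)) (geq_minr _ _).
Qed.
End Subpaths.

Section Convolution.
Variables (K : fieldType) (Q : quiver).
Local Notation KQ := (pathalg K Q).
Implicit Types (f g : KQ) (p s : qpath Q).

Lemma mcoeff_path_elt p s : mcoeff s (path_elt K p) = (p == s)%:R.
Proof. by rewrite /path_elt mcoeffU. Qed.

Lemma mcoeff_sum_msupp f (P : pred (qpath Q)) s :
  mcoeff s (\sum_(p <- msupp f | P p) mcoeff p f *: path_elt K p) =
  if P s then mcoeff s f else 0.
Proof.
rewrite raddf_sum /=; under eq_bigr do rewrite mcoeffZ mcoeff_path_elt.
have [sf|/mcoeff_outdom fs] := boolP (s \in msupp f); last first.
  rewrite fs if_same big1 // => p _; have [->|] := eqVneq p s; last by rewrite mulr0.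
  by rewrite fs mul0r.
rewrite big_mkcond (big_fsetD1 s) //= eqxx mulr1 big1_fset ?addr0 // => p.
by rewrite !inE => /andP[/negPf ->] _ _; rewrite mulr0 if_same.
Qed.

(** Multiplication in the path algebra is convolution over the factorizations
    of a path into an initial and a final subpath.  The structure of the
    ideals and modules below is read off from coefficients by this formula. *)
Lemma mcoeff_mul f g s : mcoeff s (f * g) =
  \sum_(i < (plength s).+1) mcoeff (pdrop i s) f * mcoeff (ptake i s) g.
Proof.
have mcoeffE (h : KQ) t : mcoeff t h = \sum_(p <- msupp h) mcoeff p h * (p == t)%:R.
  rewrite {1}[h]pathalgE raddf_sum /=.
  by apply: eq_bigr => p _; rewrite mcoeffZ mcoeff_path_elt.
under [RHS]eq_bigr => i _ do rewrite (mcoeffE f) (mcoeffE g) big_distrlr /=.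
rewrite exchange_big /= -[f * g]/(pa_mul f g) /pa_mul raddf_sum /=.
apply: eq_bigr => p' _.
rewrite exchange_big raddf_sum /=; apply: eq_bigr => p _.
rewrite mcoeffZ; under [RHS]eq_bigr do rewrite mulrACA.
rewrite -mulr_sumr; congr (_ * _).
have -> : mcoeff s (path_mul K p' p) = (pcomp p' p == Some s)%:R.
  by rewrite /path_mul; case: pcomp => [r|]; rewrite ?mcoeff0 // mcoeff_path_elt.
rewrite pcomp_eq_Some; case: leqP => [le_ps|lt_sp] /=; last first.
  rewrite big1 // => i _; case: (p =P _) => [pE|]; last by rewrite mulr0.
  by move: lt_sp; rewrite pE plength_take ?leq_ord // ltnNge leq_ord.
have lt_ps : (plength p < (plength s).+1)%N by [].
rewrite (bigD1 (Ordinal lt_ps)) //= -natrM mulnb big1 ?addr0 // => i ne_ip.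
case: (p =P _) => [pE|]; last by rewrite mulr0.
by case/eqP: ne_ip; apply: val_inj; rewrite /= pE plength_take ?leq_ord.
Qed.
End Convolution.

(** * Principal left ideals *)

Section PrincipalLeftIdeals.
Variable R : pzRingType.
Implicit Types x y z : R.

Definition lprincipal_incl x (a : lprincipal x) : R^o := lprincipal_val a.

Fact lprincipal_incl_linear x : linear (@lprincipal_incl x).
Proof. exact: (@linearP _ _ _ _ (\val : lprincipal x -> R^o)). Qed.

HB.instance Definition _ x := GRing.isLinear.Build R (lprincipal x) R^o *:%R
  (@lprincipal_incl x) (@lprincipal_incl_linear x).

Lemma lprincipal_incl_inj x : injective (@lprincipal_incl x).
Proof. exact: val_inj. Qed.

Lemma lprincipal_inclP x y :
  (exists a, y = a * x) <-> exists a : lprincipal x, lprincipal_incl a = y.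
Proof.
split=> [xy|[[a /asboolP xa] <-] //].
have x_y : (y : R^o) \in lideal x by apply/asboolP.
by exists (LPrincipal x_y).
Qed.

Lemma lprincipal_incl_mul x (a : lprincipal x) :
  exists c, lprincipal_incl a = c * x.
Proof. by apply/lprincipal_inclP; exists a. Qed.

(** For an idempotent [x] this is the projective cover that is used below:
    [x] is a vertex and [y] a path that ends in it. *)
Lemma lprincipal_mulr x y : x * y = y ->
  exists2 p : {linear lprincipal x -> lprincipal y},
    (forall a, lprincipal_incl (p a) = lprincipal_incl a * y) &
    forall b, exists a, p a = b.
Proof.
move=> xy.
have lin_mul : linear (fun a : lprincipal x => lprincipal_incl a * y : R^o).
  by move=> a b c; rewrite linearP mulrDl; congr (_ + _); apply/esym/mulrA.
have [|p pE] := factor_injective (f := linear_of lin_mul) (@lprincipal_incl_inj y).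
  by move=> a; apply/lprincipal_inclP; exists (lprincipal_incl a).
exists p => // b; have [c bE] := lprincipal_incl_mul b.
have /lprincipal_inclP[a aE] : exists a, c * x = a * x by exists c.
by exists a; apply: lprincipal_incl_inj; rewrite pE /= aE -mulrA xy bE.
Qed.

(** A map out of [R x] is determined by the image of [x], and an element of
    [R x] equals [a x] with [a] that element itself; so a lift [b] of the image
    of [x] gives the lift [a |-> a *: b]. *)
Lemma projective_idempotent x : x * x = x -> projective (lprincipal x).
Proof.
move=> xx B C g f sg.
have /lprincipal_inclP[u uE] : exists a, x = a * x by exists 1; rewrite mul1r.
have [b gb] := sg (f u).
have lin_h : linear (fun a : lprincipal x => (lprincipal_incl a : R) *: b).
  by move=> c a a'; rewrite linearP scalerDl scalerA.
exists (linear_of lin_h) => a /=; rewrite linearZ gb -linearZ; congr (f _).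
apply: lprincipal_incl_inj; rewrite linearZ /= uE.
have [c /= ->] := lprincipal_incl_mul a.
by rewrite /GRing.scale /= -mulrA xx.
Qed.
End PrincipalLeftIdeals.

(** * Coefficients in the truncated path algebra *)

Section TruncatedPathAlgebra.
Variables (K : fieldType) (Q : quiver) (L : nat).
Local Notation KQ := (pathalg K Q).
Local Notation Lambda := (truncalg K Q L).
Local Notation long_paths :=
  (fun x : KQ => exists2 p : qpath Q, plength p = L.+1 & x = path_elt K p).
Implicit Types (f g : KQ) (p s : qpath Q) (x y : Lambda).

(** The elements without short terms form an ideal, by the convolution formula,
    since subpaths of short paths are short; and a path longer than [L] is a
    multiple of its initial subpath of length [L + 1]. *)
Lemma long_path_idealP f :
  ideal_gen long_paths f <-> forall s, (plength s <= L)%N -> mcoeff s f = 0.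
Proof.
split=> [|f0].
  move/(_ (fun f => forall s, (plength s <= L)%N -> mcoeff s f = 0)); apply.
    split=> [s _|g h g0 h0 s le_sL|a g g0 s le_sL|a g g0 s le_sL].
    - exact: mcoeff0.
    - by rewrite mcoeffD g0 // h0 // addr0.
    - rewrite mcoeff_mul big1 // => i _; rewrite g0 ?mulr0 //.
      by rewrite plength_take ?leq_ord //; apply: leq_trans le_sL; rewrite leq_ord.
    - rewrite mcoeff_mul big1 // => i _; rewrite g0 ?mul0r //.
      by rewrite plength_drop; apply: leq_trans le_sL; rewrite leq_subr.
  move=> _ [p pL ->] s le_sL; rewrite mcoeff_path_elt.
  by case: eqP => // ps; move: le_sL; rewrite -ps pL ltnn.
have [I0 ID IM _] := ideal_gen_ideal long_paths.
rewrite [f]pathalgE; apply: big_rec => // p h _ Ih; apply: ID => //.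
have [le_pL|lt_Lp] := leqP (plength p) L; first by rewrite f0 // scale0r.
have -> : mcoeff p f *: path_elt K p =
    (mcoeff p f *: path_elt K (pdrop L.+1 p)) * path_elt K (ptake L.+1 p).
  rewrite [RHS]pa_mulZl pa_mul_path /path_mul; congr (_ *: _).
  have /eqP-> // : pcomp (pdrop L.+1 p) (ptake L.+1 p) == Some p.
  by rewrite pcomp_eq_Some plength_take // lt_Lp !eqxx.
by apply: IM => J _; apply; exists (ptake L.+1 p); rewrite ?plength_take.
Qed.

(** The representative of [x] is arbitrary, so this is meaningful only for
    paths of length at most [L]. *)
Definition pcoef s x : K := mcoeff s (rq_repr x).

Lemma pcoef_pi f s : (plength s <= L)%N -> pcoef s (rq_pi _ f) = mcoeff s f.
Proof.
move=> le_sL; apply/eqP; rewrite -subr_eq0 -mcoeffB; apply/eqP.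
apply: (iffLR (long_path_idealP _)) le_sL; apply/rq_piP; exact: rq_reprK.
Qed.

Lemma pcoef_inj x y :
  (forall s, (plength s <= L)%N -> pcoef s x = pcoef s y) -> x = y.
Proof.
move=> exy; rewrite -(rq_reprK x) -(rq_reprK y); apply/rq_piP/long_path_idealP.
by move=> s le_sL; rewrite mcoeffB [_@__]exy ?subrr.
Qed.

Lemma pcoef0 s : (plength s <= L)%N -> pcoef s 0 = 0.
Proof.
move=> le_sL; have -> : (0 : Lambda) = rq_pi _ 0; last by rewrite pcoef_pi ?mcoeff0.
by apply: (addrI (rq_pi long_paths 0)); rewrite addr0 -rq_piD addr0.
Qed.

Lemma pcoefD s x y : (plength s <= L)%N -> pcoef s (x + y) = pcoef s x + pcoef s y.
Proof.
move=> le_sL; rewrite -{1}(rq_reprK x) -{1}(rq_reprK y) -rq_piD pcoef_pi //.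
by rewrite mcoeffD.
Qed.

Lemma pcoefM s x y : (plength s <= L)%N -> pcoef s (x * y) =
  \sum_(i < (plength s).+1) pcoef (pdrop i s) x * pcoef (ptake i s) y.
Proof. by move=> le_sL; rewrite [x * y]/(rq_mul x y) pcoef_pi // mcoeff_mul. Qed.

Local Notation residue := (residue K L).

Lemma residue_mul_pi f p :
  (rq_pi long_paths f : Lambda) * residue p = rq_pi long_paths (f * path_elt K p).
Proof. exact/esym/rq_piM. Qed.

Lemma pcoef_residue p s : (plength s <= L)%N -> pcoef s (residue p) = (p == s)%:R.
Proof. by move=> le_sL; rewrite pcoef_pi // mcoeff_path_elt. Qed.

Lemma pcoef_mulr_residue x p s : (plength s <= L)%N -> pcoef s (x * residue p) =
  if starts_with p s then pcoef (pdrop (plength p) s) x else 0.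
Proof.
move=> le_sL; rewrite pcoefM //.
have le_tL (i : 'I_(plength s).+1) : (plength (ptake i s) <= L)%N.
  by rewrite plength_take ?leq_ord //; apply: leq_trans le_sL; rewrite leq_ord.
under eq_bigr => i _ do rewrite pcoef_residue //.
have [ps|nps] := boolP (starts_with p s); last first.
  rewrite big1 // => i _; case: eqP => [pE|]; last by rewrite mulr0.
  by case/negP: nps; rewrite /starts_with {1}pE plength_take ?leq_ord // -pE.
have lt_ps : (plength p < (plength s).+1)%N by apply: starts_with_length.
rewrite (bigD1 (Ordinal lt_ps)) //= eq_sym [ptake _ _ == _]ps mulr1.
rewrite big1 ?addr0 // => i ne_ip; case: eqP => [pE|]; last by rewrite mulr0.
by case/eqP: ne_ip; apply: val_inj; rewrite /= pE plength_take ?leq_ord.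
Qed.

Lemma residueM p' p r : pcomp p' p = Some r -> residue p' * residue p = residue r.
Proof.
move=> rE; rewrite {1}/residue residue_mul_pi /residue; congr rq_pi.
by rewrite path_eltM /path_mul rE.
Qed.

(** The component of [x] on the paths that start with [p] lies in
    [Lambda p]: strip [p] from these paths, and multiply by it again. *)
Lemma path_part x p : exists y,
  forall s, (plength s <= L)%N ->
    pcoef s (y * residue p) = if starts_with p s then pcoef s x else 0.
Proof.
pose c := fun s => mcoeff s (rq_repr x).
exists (rq_pi _ (\sum_(s <- msupp (rq_repr x) | starts_with p s)
  c s *: path_elt K (pdrop (plength p) s))) => s le_sL.
rewrite residue_mul_pi pcoef_pi // -mcoeff_sum_msupp.
congr mcoeff; rewrite mulr_suml; apply: eq_bigr => t pt.
rewrite [LHS]pa_mulZl; congr (_ *: _); rewrite pa_mul_path /path_mul.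
suff /eqP-> : pcomp (pdrop (plength p) t) p == Some t by [].
by rewrite pcomp_eq_Some eqxx eq_sym [ptake _ _ == _]pt starts_with_length.
Qed.

Lemma in_path_module x p :
  (exists y, x = y * residue p) <->
  forall s, (plength s <= L)%N -> pcoef s x != 0 -> starts_with p s.
Proof.
split=> [[y ->] s le_sL|px].
  by rewrite pcoef_mulr_residue //; case: ifP; rewrite // eqxx.
have [y yE] := path_part x p; exists y; apply: pcoef_inj => s le_sL.
rewrite yE //; case: ifP => // /negbT nps; apply: contraNeq nps.
exact: px.
Qed.
End TruncatedPathAlgebra.

(** * The first syzygy of the module generated by a path *)

Section FiniteDirectSums.
Variables (R : pzRingType) (T : eqType) (F : T -> lmodType R).

Fixpoint dsum (ts : seq T) : lmodType R :=
  if ts is t :: ts' then (F t * dsum ts')%type else zero_module R.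

Fixpoint dsum_map (P : lmodType R) (phi : forall t, {linear F t -> P})
    (ts : seq T) : {linear dsum ts -> P} :=
  match ts return {linear dsum ts -> P} with
  | [::] => \0
  | t :: ts' => copair (phi t) (dsum_map phi ts')
  end.

Lemma has_proj_resolution_dsum n ts :
  (forall t, t \in ts -> has_proj_resolution (F t) n) ->
  has_proj_resolution (dsum ts) n.
Proof.
elim: ts => [_|t ts IHts resF] /=.
  exact/has_proj_resolution_projective/projective_zero.
apply: has_proj_resolution_pair; first by apply: resF; rewrite mem_head.
by apply: IHts => u uts; apply: resF; rewrite inE uts orbT.
Qed.

Lemma retract_dsum t ts : t \in ts -> retract (F t) (dsum ts).
Proof.
elim: ts => //= u ts IHts; rewrite inE => /predU1P[->|/IHts rts].
  by exists (pair_of idfun \0), (copair idfun \0) => x; apply: addr0.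
apply: retract_trans rts _.
by exists (pair_of \0 idfun), (copair \0 idfun) => x; apply: add0r.
Qed.
End FiniteDirectSums.

Section PathsFrom.
Variable Q : quiver.

Definition paths_from (v : vertex Q) (n : nat) : seq (qpath Q) :=
  undup (pmap insub [seq (v, val t) | t <- enum {: n.-tuple (arrow Q)}]).

Lemma mem_paths_from v n (p : qpath Q) :
  (p \in paths_from v n) = (psrc p == v) && (plength p == n).
Proof.
rewrite mem_undup mem_pmap; apply/mapP/andP => [[[w s]]|[/eqP sp /eqP np]].
  case/mapP=> t _ [-> ->] pE.
  move: (insubP (qpath Q) (v, val t)); rewrite -pE.
  case: insubP pE => // r _ rE [->]; rewrite /psrc /plength /parrows /= rE /=.
  by rewrite eqxx size_tuple.
exists (val p); last by rewrite valK.
apply/mapP; exists (Tuple (introT eqP np : size (parrows p) == n)).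
  exact: mem_enum.
by rewrite -sp /psrc /parrows /=; case: (qpath_val p).
Qed.
End PathsFrom.

Section Syzygies.
Variables (K : fieldType) (Q : quiver) (L : nat).
Local Notation Lambda := (truncalg K Q L).
Local Notation residue := (residue K L).
Local Notation path_module := (path_module K L).
Implicit Types (p s : qpath Q) (x y : Lambda) (ts : seq (qpath Q)).

(** The sum of the submodules [Lambda p] inside [Lambda].  It is direct when
    the paths in the list are distinct and of the same length, as no path starts
    with two of them. *)
Definition internal_sum ts : {linear dsum path_module ts -> Lambda^o} :=
  dsum_map (fun p => @lprincipal_incl _ (residue p)) ts.

Lemma internal_sum_cons p ts (z : dsum path_module (p :: ts)) :
  internal_sum (p :: ts) z = lprincipal_incl z.1 + internal_sum ts z.2.
Proof. by []. Qed.

Lemma internal_sum_support ts z s : (plength s <= L)%N ->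
  pcoef s (internal_sum ts z) != 0 -> has (fun p => starts_with p s) ts.
Proof.
move=> le_sL; elim: ts z => [|p ts IHts] z; first by rewrite pcoef0 ?eqxx.
rewrite internal_sum_cons pcoefD //=.
have [ps //|nps] := boolP (starts_with p s).
have [c cE] := lprincipal_incl_mul z.1; rewrite cE.
by rewrite pcoef_mulr_residue // (negPf nps) add0r; apply: IHts.
Qed.

Lemma internal_sum_inj k ts : uniq ts -> (forall p, p \in ts -> plength p = k) ->
  forall z, internal_sum ts z = 0 -> z = 0.
Proof.
elim: ts => [_ _ z _|p ts IHts /= /andP[pts uts] lts [a z]].
  exact: zero_moduleE.
rewrite internal_sum_cons /= => az0.
have a0 : lprincipal_incl a = 0.
  apply: (@pcoef_inj K Q L) => s le_sL; rewrite pcoef0 //.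
  have [c cE] := lprincipal_incl_mul a.
  have [ps|nps] := boolP (starts_with p s); last first.
    by rewrite cE pcoef_mulr_residue // (negPf nps).
  have := pcoefD (lprincipal_incl a) (internal_sum ts z) le_sL.
  rewrite az0 pcoef0 //.
  have [->|/(internal_sum_support le_sL)/hasP[r rts rs]] :=
      eqVneq (pcoef s (internal_sum ts z)) 0; first by rewrite addr0.
  have rk : plength r = k by apply: lts; rewrite inE rts orbT.
  move: ps rs; rewrite /starts_with rk lts ?mem_head // => /eqP sp /eqP sr.
  by case/negP: pts; rewrite -sp sr.
have -> : a = 0 by apply: lprincipal_incl_inj; rewrite a0 linear0.
congr (_, _); apply: IHts => // [r rts|]; first by apply: lts; rewrite inE rts orbT.
by move: az0; rewrite a0 add0r.
Qed.

(** Remove the terms that start with the first path of the list, and go on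
    with the rest. *)
Lemma internal_sum_surj ts x :
  (forall s, (plength s <= L)%N -> pcoef s x != 0 ->
    has (fun p => starts_with p s) ts) ->
  exists z, internal_sum ts z = x.
Proof.
elim: ts x => [|p ts IHts] x xts.
  exists 0; rewrite linear0; apply: (@pcoef_inj K Q L) => s le_sL.
  by rewrite pcoef0 //; apply/esym/eqP/negPn/negP => /(xts s le_sL).
have [y yE] := path_part x p.
have [|z zE] := IHts (x - y * residue p).
  move=> s le_sL; have := pcoefD (x - y * residue p) (y * residue p) le_sL.
  rewrite subrK yE //; case: ifP => [ps|nps]; last first.
    by rewrite addr0 => <-; move: (xts s le_sL); rewrite /= nps.
  by move/eqP; rewrite -subr_eq subrr eq_sym => ->.
have /lprincipal_inclP[a aE] : exists b, y * residue p = b * residue p by exists y.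
by exists (a, z); rewrite internal_sum_cons /= aE zE addrC subrK.
Qed.

Section Syzygy.
Variable q : qpath Q.
Let e := ptgt q.
Let l := plength q.
Let k := (L.+1 - l)%N.
Hypotheses (l_gt0 : (0 < l)%N) (le_lL : (l <= L)%N).

Let vertex_module := path_module (trivial_path e).

Lemma residue_trivial_mul : residue (trivial_path e) * residue q = residue q.
Proof. by apply: residueM; rewrite pcomp_trivial_l eqxx. Qed.

Lemma projective_vertex (v : vertex Q) : projective (path_module (trivial_path v)).
Proof.
apply: projective_idempotent; apply: residueM.
by rewrite pcomp_trivial_l eqxx.
Qed.

Lemma starts_with_trivial (v : vertex Q) s :
  starts_with (trivial_path v) s = (psrc s == v).
Proof.
rewrite /starts_with ptake0; apply/eqP/eqP => [|->] //.
by move/(congr1 (@psrc Q)).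
Qed.

(** The coefficient of [s q] in [x q] is that of [s] in [x], and [s q] has
    length at most [L] exactly when [s] is shorter than [k]. *)
Lemma mulr_residue_eq0 x : x * residue q = 0 <->
  forall s, psrc s = e -> (plength s < k)%N -> pcoef s x = 0.
Proof.
split=> [xq0 s se ltsk|x0]; last first.
  apply: (@pcoef_inj K Q L) => s le_sL; rewrite pcoef0 // pcoef_mulr_residue //.
  case: ifP => // qs; apply: x0; last first.
    by rewrite plength_drop /k; move: l_gt0; rewrite /l; lia.
  by rewrite /e -[in RHS](eqP qs).
have := pcompE (esym se); case rE : (pcomp s q) => [r|] //= _.
move/eqP: (rE); rewrite pcomp_eq_Some => /and3P[le_qr /eqP sE /eqP qE].
have le_rL : (plength r <= L)%N.
  have := plength_drop l r; rewrite -sE => ls.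
  by move: ltsk le_qr; rewrite /k ls; rewrite -/l; lia.
have := pcoef_mulr_residue x q le_rL.
by rewrite /starts_with -qE eqxx -sE xq0 pcoef0.
Qed.

(** The map [p] is right multiplication by [q], and [i] is the sum of the
    inclusions.  An element of [Lambda e] lies in the kernel when its terms
    have length at least [k], that is, when each of them starts with some path
    of length [k] from [e]. *)
Lemma syzygy_path_module : exists
    (i : {linear dsum path_module (paths_from e k) -> vertex_module})
    (p : {linear vertex_module -> path_module q}), short_exact i p.
Proof.
have [p pE sp] := lprincipal_mulr residue_trivial_mul.
set ts := paths_from e k.
have [|i iE] := factor_injective (f := internal_sum ts)
                  (@lprincipal_incl_inj _ (residue (trivial_path e))).
  move=> z; apply/lprincipal_inclP/in_path_module => s le_sL.
  move/(internal_sum_support le_sL)/hasP=> [r]; rewrite mem_paths_from.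
  by rewrite starts_with_trivial => /andP[/eqP <- _] /eqP <-.
exists i, p; split=> //.
  apply: raddf_inj => z iz0; apply: (@internal_sum_inj k ts) => //.
  - exact: undup_uniq.
  - by move=> r; rewrite mem_paths_from => /andP[_ /eqP].
  - by rewrite -iE iz0 linear0.
have kp (x : vertex_module) : p x = 0 <->
    forall s, psrc s = e -> (plength s < k)%N -> pcoef s (lprincipal_incl x) = 0.
  rewrite -mulr_residue_eq0 -pE; split=> [->|px0]; first exact: linear0.
  by apply: lprincipal_incl_inj; rewrite px0 linear0.
move=> x; rewrite kp; split=> [x0|[z <-] s se lt_sk].
  have [z zE] : exists z, internal_sum ts z = lprincipal_incl x.
    apply: internal_sum_surj => s le_sL sx.
    have se : psrc s == e.
      rewrite -starts_with_trivial; apply: (iffLR (in_path_module _ _)) sx => //.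
      exact: lprincipal_incl_mul.
    have le_ks : (k <= plength s)%N.
      by rewrite leqNgt; apply: contraNN sx => /(x0 s (eqP se))/eqP.
    apply/hasP; exists (ptake k s); last by rewrite /starts_with plength_take.
    by rewrite mem_paths_from plength_take // eqxx andbT.
  by exists z; apply: lprincipal_incl_inj; rewrite iE.
rewrite [lprincipal_incl _]iE; apply/eqP/negPn/negP => /internal_sum_support.
have le_sL : (plength s <= L)%N by move: lt_sk l_gt0; rewrite /k; lia.
case/(_ le_sL)/hasP => r; rewrite mem_paths_from => /andP[_ /eqP rk].
by move/starts_with_length; rewrite rk leqNgt lt_sk.
Qed.

(** A section of [Lambda e -> Lambda q] would send [q] to some [x] with
    [x q = q], so that [e] occurs in [x] with coefficient [1], and [r] in
    [r x].  But [r q = 0] because [r q] has length [L + 1], so [r x = 0]. *)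
Lemma path_module_not_projective r : psrc r = e -> plength r = k ->
  ~ projective (path_module q).
Proof.
move=> re rk projq; have [p pE sp] := lprincipal_mulr residue_trivial_mul.
have [s sK] := projq _ _ p idfun sp.
have /lprincipal_inclP[a aE] : exists b, residue q = b * residue q.
  by exists 1; rewrite mul1r.
pose x : Lambda := lprincipal_incl (s a).
have xq : x * residue q = residue q by rewrite -pE sK.
have ra0 : residue r *: a = 0.
  apply: lprincipal_incl_inj; rewrite linearZ linear0 /= aE.
  apply: (@pcoef_inj K Q L) => t le_tL; rewrite pcoef0 // pcoef_mulr_residue //.
  case: ifP => // qt; rewrite pcoef_residue ?plength_drop; last first.
    by apply: leq_trans le_tL; rewrite leq_subr.
  case: eqP => // rt; have := starts_with_length qt.
  move: (congr1 (@plength Q) rt) l_gt0 le_lL; rewrite rk plength_drop /k -/l.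
  by lia.
have rx0 : residue r * x = 0.
  have : lprincipal_incl (s (residue r *: a)) = 0 by rewrite ra0 !linear0.
  by rewrite !linearZ.
have le_rL : (plength r <= L)%N by rewrite rk /k; move: l_gt0; lia.
have := pcoefM (residue r) x le_rL; rewrite rx0 pcoef0 // big_ord_recl big1.
  rewrite addr0 pcoef_residue; last by rewrite plength_drop subn0.
  rewrite pdrop0 eqxx mul1r ptake0 re => x0.
  have := pcoef_mulr_residue x q le_lL; rewrite xq pcoef_residue // eqxx.
  rewrite /starts_with ptake_plength eqxx pdrop_plength.
  by rewrite -x0 => /eqP; rewrite oner_eq0.
move=> i _; rewrite pcoef_residue; last first.
  by rewrite plength_drop (leq_trans _ le_rL) // leq_subr.
case: eqP => [/(congr1 (@plength Q))|]; last by rewrite mul0r.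
rewrite plength_drop /= => rE; have := ltn_ord i; rewrite /bump /= in rE *; lia.
Qed.
End Syzygy.
End Syzygies.

(** * The two bounds for the projective dimension *)

Section LDegree.
Local Open Scope nat_scope.
Variable L : nat.

Definition ldegn (l c : nat) := c %/ L.+1 + (c + l) %/ L.+1.

Lemma ldegn_small l c : c + l <= L -> ldegn l c = 0.
Proof. by move=> le_clL; rewrite /ldegn !divn_small //; lia. Qed.

(** With [k = L + 1 - l] one has [c + l = (c - k) + (L + 1)] and
    [(c - k) + k = c], so the two quotients are swapped, and one of them drops
    by one. *)
Lemma ldegn_syzygy l c : l <= L -> L.+1 <= c + l ->
  ldegn l c = (ldegn (L.+1 - l) (c - (L.+1 - l))).+1.
Proof.
move=> le_lL le_Lcl; rewrite /ldegn subnK; last by lia.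
have -> : c + l = c - (L.+1 - l) + L.+1 by lia.
by rewrite divnDr // divnn /=; lia.
Qed.

Lemma ldegn_mono l l' c : l <= l' -> ldegn l c <= ldegn l' c.
Proof. by move=> le_ll'; rewrite leq_add2l leq_div2r // leq_add2l. Qed.

(** Lengths up to [L] shift the numerator by less than the denominator. *)
Lemma ldegn_leS l l' c : l' <= L -> ldegn l' c <= (ldegn l c).+1.
Proof.
move=> le_lL'; rewrite /ldegn -addnS leq_add2l.
have -> : ((c + l) %/ L.+1).+1 = (c + l + L.+1) %/ L.+1.
  by rewrite [RHS]divnDr // divnn addn1.
by apply: leq_div2r; lia.
Qed.

Lemma ldegn_unbounded l m : m <= ldegn l (m * L.+1).
Proof. by rewrite /ldegn mulnK // leq_addr. Qed.
End LDegree.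

Section ProjectiveDimension.
Variables (K : fieldType) (Q : quiver) (L : nat).
Implicit Types (p q r : qpath Q) (c n : nat).
Local Notation path_module := (path_module K L).

Lemma pcomp_ex p r : psrc r = ptgt p ->
  exists2 s, psrc s = psrc p & plength s = (plength p + plength r)%N.
Proof.
move=> e; have := pcompE (esym e).
case: (pcomp r p) (@pcompP _ r p) => // s sP _.
have [_ ss sa] := sP s erefl; exists s => //.
by rewrite /plength sa size_cat.
Qed.

(** Strong induction on [c]: a path [p] of the syzygy is prolonged by at most
    [c - k] arrows, [k] being its length. *)
Lemma path_module_upper c q : (0 < plength q <= L)%N ->
  (forall p, psrc p = ptgt q -> (plength p <= c)%N) ->
  has_proj_resolution (path_module q) (ldegn L (plength q) c).
Proof.
elim/ltn_ind: c q => c IHc q /andP[l_gt0 le_lL] le_c.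
set k := (L.+1 - plength q)%N.
have [i [p ip]] := syzygy_path_module K l_gt0 le_lL.
have projE := @projective_vertex K Q L (ptgt q).
have [lt_ck|le_kc] := ltnP c k.
  rewrite ldegn_small; last by move: lt_ck; rewrite /k; lia.
  apply: has_proj_resolution_projective; case: ip => _ sp kp.
  apply: (projective_iso sp) projE => x /kp[y <-].
  have paths0 : paths_from (ptgt q) k = [::].
    case rsE: (paths_from _ _) => [|r rs] //.
    have := mem_head r rs; rewrite -rsE mem_paths_from => /andP[/eqP re /eqP rk].
    by move: lt_ck; rewrite ltnNge -rk le_c.
  (* The direct sum is now empty, and the kernel of [p] is zero. *)
  by move: i y {kp}; rewrite paths0 => i y; rewrite (zero_moduleE y) linear0.
rewrite ldegn_syzygy //; last by move: le_kc; rewrite /k; lia.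
apply: has_proj_resolution_cons ip projE _.
apply: has_proj_resolution_dsum => r.
rewrite mem_paths_from => /andP[/eqP re /eqP rk].
rewrite -rk; apply: IHc; first by move: le_kc; rewrite rk /k; lia.
  by rewrite rk /k; lia.
move=> s sr; have [t ts tn] := pcomp_ex sr.
by have := le_c t (etrans ts re); rewrite tn; lia.
Qed.

(** Descent along [r]: its initial subpath of length [k] indexes a summand of
    the syzygy, and the rest of [r] is a path that starts at its end. *)
Lemma path_module_lower q r n : (0 < plength q <= L)%N -> psrc r = ptgt q ->
  retract_resolution (path_module q) n ->
  (ldegn L (plength q) (plength r) <= n)%N.
Proof.
move c_r: (plength r) => c.
elim/ltn_ind: c q r n c_r => c IHc q r n rc /andP[l_gt0 le_lL] re res.
set k := (L.+1 - plength q)%N.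
have [lt_ck|le_kc] := ltnP c k.
  by rewrite ldegn_small //; move: lt_ck; rewrite /k; lia.
have kr : plength (ptake k r) = k by rewrite plength_take ?rc.
case: n res => [/retract_resolution0|n res].
  by move/(@path_module_not_projective K Q L q l_gt0 le_lL (ptake k r) re kr).
rewrite ldegn_syzygy //; last by move: le_kc; rewrite /k; lia.
have [i [p ip]] := syzygy_path_module K l_gt0 le_lL.
have projE := @projective_vertex K Q L (ptgt q).
have := retract_resolution_shift ip projE res.
have /(retract_dsum (fun p => path_module p)) : ptake k r \in paths_from (ptgt q) k.
  by rewrite mem_paths_from kr eqxx andbT; apply/eqP.
move=> /retract_resolution_retract/[apply] => resr.
rewrite ltnS -/k -{1}kr.
apply: (IHc (c - k)%N _ (ptake k r) (pdrop k r)) => //.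
- by move: le_kc l_gt0; rewrite /k; lia.
- by rewrite plength_drop rc.
- by rewrite kr /k; lia.
Qed.
End ProjectiveDimension.

(** * Path lengths and oriented cycles *)

Section PathLengths.
Variable Q : quiver.
Implicit Types (p r s z : qpath Q) (e v : vertex Q).

Lemma enat_inf_Some (A : nat -> Prop) n :
  enat_inf A = Some n -> A n /\ forall m, A m -> (n <= m)%N.
Proof.
rewrite /enat_inf; case: pselect => // exA [<-].
case: ex_minnP => m /asboolP Am m_min; split=> // j /asboolP; exact: m_min.
Qed.

Lemma enat_inf_None (A : nat -> Prop) n : enat_inf A = None -> ~ A n.
Proof.
rewrite /enat_inf; case: pselect => // nexA _ An.
by apply: nexA; exists n; apply/asboolP.
Qed.

Lemma path_of_smaller_length p n : (n <= plength p)%N ->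
  exists2 r, psrc r = psrc p & plength r = n.
Proof. by move=> le_np; exists (ptake n p); rewrite ?plength_take. Qed.

(** The supremum is attained: for [c = 0] by the trivial path; and if no path
    had length [c > 0], then [c - 1] would already be an upper bound. *)
Lemma max_path_length_Some e c : max_path_length e = Some c ->
  (exists2 r, psrc r = e & plength r = c) /\
  forall p, psrc p = e -> (plength p <= c)%N.
Proof.
move=> /enat_inf_Some[c_ub c_min]; split; last by move=> p pe; apply: c_ub; exists p.
case: c => [|c] in c_ub c_min *; first by exists (trivial_path e).
apply: contrapT => no_r; suff: (c.+1 <= c)%N by rewrite ltnn.
apply: c_min => n [p pe pn]; rewrite -ltnS ltn_neqAle; apply/andP; split; last first.
  by apply: c_ub; exists p.
by apply/eqP => nc; apply: no_r; exists p; rewrite // pn.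
Qed.

(** There are paths longer than [n], and these are cut off at [n]. *)
Lemma max_path_length_None e n : max_path_length e = None ->
  exists2 r, psrc r = e & plength r = n.
Proof.
move=> /(enat_inf_None (n := n)) n_ub; apply: contrapT => no_r; apply: n_ub.
move=> m [p pe pm]; rewrite leqNgt; apply/negP => lt_nm; apply: no_r.
by rewrite -pe; apply: path_of_smaller_length; rewrite pm ltnW.
Qed.

Lemma max_path_length_bounded e b :
  (forall p, psrc p = e -> (plength p <= b)%N) -> max_path_length e <> None.
Proof.
move=> le_b /(max_path_length_None b.+1)[p pe pb].
by have := le_b p pe; rewrite pb ltnn.
Qed.

Lemma ptgt_take v0 i p : (i <= plength p)%N ->
  ptgt (ptake i p) = nth v0 (pvertices p) i.
Proof.
move=> le_ip; rewrite /ptgt (last_nth v0) size_map -/(plength _) plength_take //.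
have -> : psrc (ptake i p) :: map (@atgt Q) (parrows (ptake i p)) =
    take i.+1 (pvertices p) by rewrite /= -map_take.
by rewrite nth_take.
Qed.

(** Pigeonhole: the path visits one more vertex than it has arrows, and the
    part between two visits to the same vertex is a cycle. *)
Lemma long_path_meets_cycle p : (#|vertex Q| <= plength p)%N ->
  exists2 r, psrc r = psrc p & on_oriented_cycle (ptgt r).
Proof.
move=> le_Vp; have /(uniqPn (psrc p))[i [j [lt_ij lt_j ij]]] : ~~ uniq (pvertices p).
  apply/negP => /card_uniqP; have := max_card (mem (pvertices p)).
  rewrite /= size_map -/(plength p) => le1 E.
  by move: le_Vp; rewrite -ltnS -E ltnNge le1.
have le_jp : (j <= plength p)%N by move: lt_j; rewrite /= size_map ltnS.
have le_ip : (i <= plength p)%N by apply: leq_trans le_jp; exact: ltnW.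
exists (ptake i p) => //; exists (pdrop i (ptake j p)).
  split; first by rewrite plength_drop plength_take // subn_gt0.
  rewrite psrc_drop ptgt_drop ptake_take 1?ltnW //.
  by rewrite !(ptgt_take (psrc p)).
by rewrite /pvertices inE psrc_drop ptake_take ?eqxx // ltnW.
Qed.

Lemma cycle_long_paths z n : oriented_cycle z ->
  exists2 s, psrc s = ptgt z & (n <= plength s)%N.
Proof.
move=> [z_gt0 zz]; elim: n => [|n [s sz le_ns]].
  by exists (trivial_path (ptgt z)).
have [t tz tn] := pcomp_ex sz; exists t; first by rewrite tz.
by rewrite tn; lia.
Qed.

(** From the end of [p], follow the cycle [z] to its base point, and then go
    round it [n] times. *)
Lemma on_cycle_long_paths p n : on_oriented_cycle (ptgt p) ->
  exists2 s, psrc s = psrc p & (n <= plength s)%N.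
Proof.
move=> [z cz vz]; have [s sz le_ns] := cycle_long_paths n cz.
have le_iz : (index (ptgt p) (pvertices z) <= plength z)%N.
  by move: vz; rewrite -index_mem /= size_map.
have [t tz tn] := @pcomp_ex _ (pdrop (index (ptgt p) (pvertices z)) z) s
                    (etrans sz (esym (ptgt_drop _ _))).
have tp : psrc t = ptgt p.
  by rewrite tz psrc_drop (ptgt_take (ptgt p)) // nth_index.
have [u up un] := pcomp_ex tp; exists u => //.
by rewrite un tn; lia.
Qed.

Lemma max_path_length_finite e : max_path_length e <> None <->
  ~ (exists2 p : qpath Q, psrc p = e & on_oriented_cycle (ptgt p)).
Proof.
split=> [fin_e [p pe cp]|no_cycle].
  case c_e: (max_path_length e) fin_e => [c|] // _.
  have [_ le_c] := max_path_length_Some c_e.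
  have [s sp] := on_cycle_long_paths c.+1 cp.
  by rewrite ltnNge le_c // sp.
apply: (@max_path_length_bounded e #|vertex Q|) => p pe; rewrite leqNgt.
apply/negP => /ltnW/long_path_meets_cycle[r rp cr].
by apply: no_cycle; exists r; rewrite ?rp.
Qed.
End PathLengths.

(** * The projective dimension *)

Lemma pdim_path_module (K : fieldType) (Q : quiver) (L : nat) (q : qpath Q) :
  (0 < plength q <= L)%N ->
  pdim (path_module K L q) = ldeg L (plength q) (max_path_length (ptgt q)).
Proof.
move=> lP; case c_e: (max_path_length (ptgt q)) => [c|] /=.
  have [[r re rc] le_c] := max_path_length_Some c_e.
  have up := path_module_upper K lP le_c.
  rewrite /pdim; case dq: (enat_inf _) => [n|]; last by case: (enat_inf_None dq up).
  have [/retract_resolution_refl res_n n_min] := enat_inf_Some dq.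
  have := path_module_lower lP re res_n; rewrite rc => le_dn.
  by congr Some; apply/eqP; rewrite eqn_leq n_min.
rewrite /pdim; case dq: (enat_inf _) => [n|] //.
have [/retract_resolution_refl res_n _] := enat_inf_Some dq.
(* The first quotient alone shows that a path of length (n + 1)(L + 1)
   excludes the projective dimension n. *)
have [r re rc] := max_path_length_None (n.+1 * L.+1) c_e.
have := leq_trans (ldegn_unbounded L (plength q) n.+1).
by rewrite -rc => /(_ _ (path_module_lower lP re res_n)); rewrite ltnn.
Qed.

Theorem theorem5 (K : fieldType) (Q : quiver) (L : nat) (hL : (0 < L)%N)
    (q : qpath Q) (l : nat) (hl : plength q = l) (hl0 : (0 < l)%N)
    (hlL : (l <= L)%N) (e : vertex Q) (he : ptgt q = e) :
  [/\ pdim (path_module K L q) = ldeg L l (max_path_length e),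
      pdim (path_module K L q) <> None <-> max_path_length e <> None,
      max_path_length e <> None <->
        ~ (exists2 p : qpath Q, psrc p = e & on_oriented_cycle (ptgt p)) &
      forall q' : qpath Q, ptgt q' = e ->
        (plength q <= plength q')%N -> (plength q' <= L)%N ->
        enat_le (pdim (path_module K L q)) (pdim (path_module K L q')) /\
        enat_le (pdim (path_module K L q'))
                (enat_succ (pdim (path_module K L q)))].
Proof.
have pdq : pdim (path_module K L q) = ldeg L l (max_path_length e).
  by rewrite -he -hl; apply: pdim_path_module; rewrite hl hl0.
split=> //; first by rewrite pdq; case: max_path_length.
  exact: max_path_length_finite.
move=> q' q'e le_qq' le_q'L; rewrite pdq pdim_path_module; last first.
  by rewrite le_q'L (leq_trans _ le_qq') // hl.
rewrite q'e -hl; case: max_path_length => [c|] //=.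
by split; [apply: ldegn_mono | apply: ldegn_leS].
Qed.
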